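(* Let $ML^n_p=(J^1(T,M),L)$ be a metrical multi-time Lagrange space with respect to the semi-Riemannian metric $h$ on $T$, and let $G$ be the gravitational $h$-potential induced by its Kronecker $h$-regular Lagrangian function $L$. The Einstein equations which govern $G$, namely $$Ric(C\Gamma)-\frac{Sc(C\Gamma)}2G=\mathcal K\mathcal T,$$ take, in adapted local components, the form: (i) for $p=\dim T=1$, $$-\frac{R+S}2h_{11}=\mathcal K\mathcal T_{11},\qquad R_{ij}-\frac{R+S}2g_{ij}=\mathcal K\mathcal T_{ij},\qquad S^{(1)(1)}_{(i)(j)}-\frac{R+S}2h^{11}g_{ij}=\mathcal K\mathcal T^{(1)(1)}_{(i)(j)},$$ $$0=\mathcal T_{1i},\quad R_{i1}=\mathcal K\mathcal T_{i1},\quad P^{(1)}_{(i)1}=\mathcal K\mathcal T^{(1)}_{(i)1},\quad 0=\mathcal T^{\;(1)}_{1(i)},\quad P^{\;(1)}_{i(j)}=\mathcal K\mathcal T^{\;(1)}_{i(j)},\quad P^{(1)}_{(i)j}=\mathcal K\mathcal T^{(1)}_{(i)j};$$ (ii) for $p=\dim T\ge2$, $$H_{\alpha\beta}-\frac{H+R}2h_{\alpha\beta}=\mathcal K\mathcal T_{\alpha\beta},\qquad R_{ij}-\frac{H+R}2g_{ij}=\mathcal K\mathcal T_{ij},\qquad -\frac{H+R}2h^{\alpha\beta}g_{ij}=\mathcal K\mathcal T^{(\alpha)(\beta)}_{(i)(j)},$$ $$0=\mathcal T_{\alpha i},\quad R_{i\alpha}=\mathcal K\mathcal T_{i\alpha},\quad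 0=\mathcal T^{(\alpha)}_{(i)\beta},\quad 0=\mathcal T^{\;(\beta)}_{\alpha(i)},\quad 0=\mathcal T^{\;(\alpha)}_{i(j)},\quad 0=\mathcal T^{(\alpha)}_{(i)j},$$ where $\mathcal T_{AB}$, $A,B\in\{\alpha,i,{}^{(\alpha)}_{(i)}\}$, are the adapted local components of the stress-energy d-tensor $\mathcal T$.
   Context: **Space.** $T$ (dimension $p$, coordinates $t^\alpha$) and $M$ (dimension $n$, coordinates $x^i$) are smooth real manifolds; $E=J^1(T,M)\to T\times M$ is the first-order jet bundle with induced coordinates $(t^\alpha,x^i,x^i_\alpha)$. Greek indices run over $1,\dots,p$, Latin over $1,\dots,n$; repeated indices are summed. If $p=1$ write $t=t^1$, $y^i=x^i_1$. $h=(h_{\alpha\beta}(t))$ is a fixed semi-Riemannian metric on $T$ with inverse $(h^{\alpha\beta})$ and Christoffel symbols $H^\gamma_{\alpha\beta}=\frac{h^{\gamma\eta}}2\left(\frac{\partial h_{\eta\alpha}}{\partial t^\beta}+\frac{\partial h_{\eta\beta}}{\partial t^\alpha}-\frac{\partial h_{\alpha\beta}}{\partial t^\eta}\right)$. A metrical multi-time Lagrange space $ML^n_p=(J^1(T,M),L)$ is given by a smooth $L:E\to\mathbb R$ that is Kronecker $h$-regular: $G^{(\alpha)(\beta)}_{(i)(j)}:=\frac12\frac{\partial^2L}{\partial x^i_\alpha\partial x^j_\beta}=h^{\alpha\beta}g_{ij}$, with $g_{ij}$ a symmetric d-tensor (distinguished tensor) on $E$ of rank $n$ and constant signature, with inverse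 $g^{ij}$. For $p\ge2$ it is known that then $g_{ij}=g_{ij}(t,x)$ and $L=h^{\alpha\beta}(t)g_{ij}(t,x)x^i_\alpha x^j_\beta+U^{(\alpha)}_{(i)}(t,x)x^i_\alpha+F(t,x)$; put $U^{(\beta)}_{(k)j}=\frac{\partial U^{(\beta)}_{(k)}}{\partial x^j}-\frac{\partial U^{(\beta)}_{(j)}}{\partial x^k}$. **Canonical nonlinear connection** $\Gamma=(M^{(i)}_{(\alpha)\beta},N^{(i)}_{(\alpha)j})$: $M^{(i)}_{(\alpha)\beta}=-H^\gamma_{\alpha\beta}x^i_\gamma$. For $p=1$: $N^{(i)}_{(1)j}=h_{11}\frac{\partial\mathcal G^i}{\partial y^j}$ with $\mathcal G^i=\frac{g^{ik}}4\left(\frac{\partial^2L}{\partial x^j\partial y^k}y^j-\frac{\partial L}{\partial x^k}+\frac{\partial^2L}{\partial t\partial y^k}+\frac{\partial L}{\partial y^k}H^1_{11}+2h^{11}H^1_{11}g_{kl}y^l\right)$. For $p\ge2$: $N^{(i)}_{(\alpha)j}=\Gamma^i_{jk}x^k_\alpha+\frac{g^{ik}}2\frac{\partial g_{jk}}{\partial t^\alpha}+\frac{g^{ik}}4h_{\alpha\beta}U^{(\beta)}_{(k)j}$, with $\Gamma^i_{jk}=\frac{g^{im}}2\left(\frac{\partial g_{mj}}{\partial x^k}+\frac{\partial g_{mk}}{\partial x^j}-\frac{\partial g_{jk}}{\partial x^m}\right)$. Adapted basis $(X_A)$: $X_\alpha=\frac{\delta}{\delta t^\alpha}=\frac{\partial}{\partial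 t^\alpha}-M^{(j)}_{(\beta)\alpha}\frac{\partial}{\partial x^j_\beta}$, $X_i=\frac{\delta}{\delta x^i}=\frac{\partial}{\partial x^i}-N^{(j)}_{(\beta)i}\frac{\partial}{\partial x^j_\beta}$, and $\frac{\partial}{\partial x^i_\alpha}$ (index ${}^{(\alpha)}_{(i)}$); dual vertical forms $\delta x^i_\alpha=dx^i_\alpha+M^{(i)}_{(\alpha)\beta}dt^\beta+N^{(i)}_{(\alpha)j}dx^j$. **Cartan canonical connection** $C\Gamma=(H^\gamma_{\alpha\beta},G^k_{j\gamma},L^i_{jk},C^{i(\gamma)}_{j(k)})$: $G^k_{j\gamma}=\frac{g^{ki}}2\frac{\delta g_{ij}}{\delta t^\gamma}$, $L^i_{jk}=\frac{g^{im}}2\left(\frac{\delta g_{mj}}{\delta x^k}+\frac{\delta g_{mk}}{\delta x^j}-\frac{\delta g_{jk}}{\delta x^m}\right)$, $C^{i(\gamma)}_{j(k)}=\frac{g^{im}}2\left(\frac{\partial g_{mj}}{\partial x^k_\gamma}+\frac{\partial g_{mk}}{\partial x^j_\gamma}-\frac{\partial g_{jk}}{\partial x^m_\gamma}\right)$. It is the linear connection $\nabla$ on $E$ with: $\nabla_{\delta/\delta t^\gamma}$ sending $\frac{\delta}{\delta t^\alpha}\mapsto H^\mu_{\alpha\gamma}\frac{\delta}{\delta t^\mu}$, $\frac{\delta}{\delta x^i}\mapsto G^k_{i\gamma}\frac{\delta}{\delta x^k}$, $\frac{\partial}{\partial x^i_\alpha}\mapsto(\delta^\alpha_\mu G^k_{i\gamma}-\delta^k_iH^\alpha_{\mu\gamma})\frac{\partial}{\partial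 x^k_\mu}$; $\nabla_{\delta/\delta x^j}$ sending $\frac{\delta}{\delta t^\alpha}\mapsto0$, $\frac{\delta}{\delta x^i}\mapsto L^k_{ij}\frac{\delta}{\delta x^k}$, $\frac{\partial}{\partial x^i_\alpha}\mapsto L^k_{ij}\frac{\partial}{\partial x^k_\alpha}$; $\nabla_{\partial/\partial x^j_\gamma}$ sending $\frac{\delta}{\delta t^\alpha}\mapsto0$, $\frac{\delta}{\delta x^i}\mapsto C^{k(\gamma)}_{i(j)}\frac{\delta}{\delta x^k}$, $\frac{\partial}{\partial x^i_\alpha}\mapsto C^{k(\gamma)}_{i(j)}\frac{\partial}{\partial x^k_\alpha}$. **Curvature, Ricci, scalar curvature.** $\mathbf R(X,Y)Z=\nabla_X\nabla_YZ-\nabla_Y\nabla_XZ-\nabla_{[X,Y]}Z$, $\mathbf R(X_C,X_B)X_A=R^D_{ABC}X_D$, $R_{AB}=Ric(X_A,X_B)=R^D_{ABD}$. Notation: $H_{\alpha\beta}=Ric(\frac{\delta}{\delta t^\alpha},\frac{\delta}{\delta t^\beta})$, $R_{i\alpha}=Ric(\frac{\delta}{\delta x^i},\frac{\delta}{\delta t^\alpha})$, $R_{ij}=Ric(\frac{\delta}{\delta x^i},\frac{\delta}{\delta x^j})$, $P^{\;(\alpha)}_{i(j)}=Ric(\frac{\delta}{\delta x^i},\frac{\partial}{\partial x^j_\alpha})$, $P^{(\alpha)}_{(i)j}=Ric(\frac{\partial}{\partial x^i_\alpha},\frac{\delta}{\delta x^j})$, $P^{(\alpha)}_{(i)\beta}=Ric(\frac{\partial}{\partial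 x^i_\alpha},\frac{\delta}{\delta t^\beta})$, $S^{(\alpha)(\beta)}_{(i)(j)}=Ric(\frac{\partial}{\partial x^i_\alpha},\frac{\partial}{\partial x^j_\beta})$; $H=h^{\alpha\beta}H_{\alpha\beta}$, $R=g^{ij}R_{ij}$, $S=h_{\alpha\beta}g^{ij}S^{(\alpha)(\beta)}_{(i)(j)}$. **Gravitational potential and Einstein equations.** The gravitational $h$-potential of $ML^n_p$ is $G=h_{\alpha\beta}dt^\alpha\otimes dt^\beta+g_{ij}dx^i\otimes dx^j+h^{\alpha\beta}g_{ij}\delta x^i_\alpha\otimes\delta x^j_\beta$; $Sc(C\Gamma)=G^{AB}R_{AB}$ with $(G^{AB})$ the inverse of $G$ in the adapted basis (blocks $h^{\alpha\beta}$, $g^{ij}$, $h_{\alpha\beta}g^{ij}$, zero otherwise). The Einstein equations governing $G$ are postulated to be those attached to $C\Gamma$ and $G$. $\mathcal K$ is the Einstein constant and $\mathcal T$ is an intrinsic tensor of matter, a $(0,2)$ d-tensor on $E$ called the stress-energy d-tensor, with adapted components $\mathcal T_{AB}=\mathcal T(X_A,X_B)$, e.g. $\mathcal T_{1i}=\mathcal T(\frac{\delta}{\delta t},\frac{\delta}{\delta x^i})$, $\mathcal T^{\;(\beta)}_{\alpha(i)}=\mathcal T(\frac{\delta}{\delta t^\alpha},\frac{\partial}{\partial x^i_\beta})$, $\mathcal T^{(\alpha)}_{(i)j}=\mathcal T(\frac{\partial}{\partial x^i_\alpha},\frac{\delta}{\delta x^j})$, etc. *)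

(* Defs.v *)
From HB Require Import structures.
From mathcomp Require Import all_boot all_order all_algebra.
From mathcomp Require Import boolp classical_sets functions reals topology.
From mathcomp Require Import normedtype derive.

Set Implicit Arguments.
Unset Strict Implicit.
Unset Printing Implicit Defensive.
Import Order.TTheory GRing.Theory Num.Theory.
Import numFieldNormedType.Exports.

Local Open Scope classical_set_scope.
Local Open Scope ring_scope.

(* C^oo on an open set U: every iterated directional derivative exists and is
   (Frechet) differentiable at every point of U. *)
Definition smooth_on (R : realType) (V W : normedModType R) (U : set V)
    (f : V -> W) : Prop :=
  forall (vs : seq V) (x : V), U x ->
    differentiable (foldr (fun v (k : V -> W) => 'D_v k) f vs) x.

(* [chart_inv] is only meaningful on the image of [chart_dom]. *)
Record chart (R : realType) (d : nat) (X : topologicalType) := Chart {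
  chart_dom : set X;
  chart_map : X -> 'rV[R]_d;
  chart_inv : 'rV[R]_d -> X;
  chart_dom_open : open chart_dom;
  chart_im_open : open (chart_map @` chart_dom);
  chart_mapK : forall x, chart_dom x -> chart_inv (chart_map x) = x;
  chart_map_cont : forall x, chart_dom x -> {for x, continuous chart_map};
  chart_inv_cont : forall u, (chart_map @` chart_dom) u ->
    {for u, continuous chart_inv} }.

Definition chart_im (R : realType) (d : nat) (X : topologicalType)
  (c : chart R d X) : set 'rV[R]_d := chart_map c @` chart_dom c.

Definition overlap (R : realType) (d : nat) (X : topologicalType)
  (c c' : chart R d X) : set 'rV[R]_d :=
  chart_map c @` (chart_dom c `&` chart_dom c').

Definition trans (R : realType) (d : nat) (X : topologicalType)
  (c c' : chart R d X) : 'rV[R]_d -> 'rV[R]_d := chart_map c' \o chart_inv c.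

Record manifold (R : realType) (d : nat) := Manifold {
  pts :> topologicalType;
  pts_hausdorff : hausdorff_space pts;
  pts_second_countable : @second_countable pts;
  atlas : set (chart R d pts);
  atlas_cover : forall x : pts, exists2 c, atlas c & chart_dom c x;
  atlas_smooth : forall c c', atlas c -> atlas c' ->
    smooth_on (overlap c c') (trans c c') }.

(* A symmetric matrix has signature (n - q, q), in the sense of Sylvester. *)
Definition has_signature (R : realType) (n q : nat) (A : 'M[R]_n) : Prop :=
  (q <= n)%N /\ exists2 P : 'M[R]_n, P \in unitmx &
    P *m A *m P^T = diag_mx (\row_(i < n) (if (i < q)%N then -1 else 1)).

(* A semi-Riemannian metric: its components h_{ab} in each chart. The Jacobian
   acts on row vectors, ('J f x) a c being the derivative of the c-th component
   of f with respect to the a-th coordinate. *)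
Record semiriemannian (R : realType) (p : nat) (T : manifold R p) := Metric {
  met :> chart R p T -> 'rV[R]_p -> 'M[R]_p;
  met_smooth : forall c, atlas c -> smooth_on (chart_im c) (met c);
  met_sym : forall c t, atlas c -> chart_im c t -> (met c t)^T = met c t;
  met_signature : exists q : nat, forall c t, atlas c -> chart_im c t ->
    has_signature q (met c t);
  met_tensor : forall c c' t, atlas c -> atlas c' -> overlap c c' t ->
    met c t = 'J (trans c c') t *m met c' (trans c c' t)
              *m ('J (trans c c') t)^T }.

Section Jets.
Context (R : realType) (p n : nat) (T : manifold R p) (M : manifold R n).

Definition local_rep (c : chart R p T) (d : chart R n M) (f : T -> M) :
    'rV[R]_p -> 'rV[R]_n := chart_map d \o f \o chart_inv c.

Definition smooth_at (t : T) (f : T -> M) : Prop :=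
  forall c d, atlas c -> atlas d -> chart_dom c t -> chart_dom d (f t) ->
  exists W : set 'rV[R]_p,
    [/\ open W, W (chart_map c t),
        W `<=` chart_map c @` (chart_dom c `&` f @^-1` chart_dom d)
      & smooth_on W (local_rep c d f)].

Definition same_1jet (t : T) (f f' : T -> M) : Prop :=
  f t = f' t /\
  forall c d, atlas c -> atlas d -> chart_dom c t -> chart_dom d (f t) ->
    'J (local_rep c d f) (chart_map c t) = 'J (local_rep c d f') (chart_map c t).

(* The 1-jet j^1_t f, as a class of pairs (t, f') with f' smooth near t. *)
Definition jet1 (t : T) (f : T -> M) : set (T * (T -> M)) :=
  [set b | [/\ b.1 = t, smooth_at t b.2 & same_1jet t f b.2]].

(* Coordinates (t^a, x^i, x^i_a) on J^1(T,M): e.1.1 0 a, e.1.2 0 i, e.2 a i. *)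
Definition jcoord := ('rV[R]_p * 'rV[R]_n * 'M[R]_(p, n))%type.

Definition jet_dom (c : chart R p T) (d : chart R n M) : set jcoord :=
  [set e | chart_im c e.1.1 /\ chart_im d e.1.2].

(* The jet with coordinates e, represented by a map affine in the charts; the
   behaviour of this map away from the base point is irrelevant. *)
Definition jet_of (c : chart R p T) (d : chart R n M) (e : jcoord) :
    set (T * (T -> M)) :=
  jet1 (chart_inv c e.1.1)
    (fun s => chart_inv d (e.1.2 + (chart_map c s - e.1.1) *m e.2)).

Definition jet_overlap (c c' : chart R p T) (d d' : chart R n M) : set jcoord :=
  [set e | overlap c c' e.1.1 /\ overlap d d' e.1.2].

(* t' = t'(t), x' = x'(x), x'^i_a = (dx'^i/dx^j) (dt^b/dt'^a) x^j_b *)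
Definition jet_trans (c c' : chart R p T) (d d' : chart R n M) (e : jcoord) :
    jcoord :=
  (trans c c' e.1.1, trans d d' e.1.2,
   'J (trans c' c) (trans c c' e.1.1) *m e.2 *m 'J (trans d d') e.1.2).

End Jets.

Arguments jcoord : clear implicits.

(* Coordinate expressions in one induced chart of J^1(T,M) with coordinate
   domain D, in which h, g and L are given by their components. *)
Section Local.
Context (R : realType) (p n : nat).
Local Notation E := (jcoord R p n).
Context (D : set E) (h : 'rV[R]_p -> 'M[R]_p) (g : E -> 'M[R]_n) (L : E -> R).

Definition hinv (t : 'rV[R]_p) : 'M[R]_p := invmx (h t).
Definition ginv (e : E) : 'M[R]_n := invmx (g e).

Definition d_t (a : 'I_p) : E := (delta_mx 0 a, 0, 0).
Definition d_x (i : 'I_n) : E := (0, delta_mx 0 i, 0).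
Definition d_y (a : 'I_p) (i : 'I_n) : E := (0, 0, delta_mx a i).

Definition d_h (a b c : 'I_p) (t : 'rV[R]_p) : R :=
  'D_(delta_mx 0 c) (fun s => h s a b) t.

(* H^c_{ab} *)
Definition Hc (c a b : 'I_p) (t : 'rV[R]_p) : R :=
  \sum_m hinv t c m / 2 * (d_h m a b t + d_h m b a t - d_h a b m t).

(* G^{(a)(b)}_{(i)(j)} = h^{ab} g_{ij} on D *)
Definition kronecker_regular : Prop :=
  forall (e : E) (a b : 'I_p) (i j : 'I_n), D e ->
    1 / 2 * 'D_(d_y a i) ('D_(d_y b j) L) e = hinv e.1.1 a b * g e i j.

(* M^{(i)}_{(a)b} *)
Definition Mcon (i : 'I_n) (a b : 'I_p) (e : E) : R :=
  - \sum_c Hc c a b e.1.1 * e.2 c i.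

(* Spray G^i for p = 1; [o] stands for the only index 1 of 'I_p, and
   y^j = e.2 o j. *)
Definition spray (o : 'I_p) (i : 'I_n) (e : E) : R :=
  \sum_k ginv e i k / 4 *
    (\sum_j 'D_(d_x j) ('D_(d_y o k) L) e * e.2 o j
     - 'D_(d_x k) L e
     + 'D_(d_t o) ('D_(d_y o k) L) e
     + 'D_(d_y o k) L e * Hc o o o e.1.1
     + 2 * hinv e.1.1 o o * Hc o o o e.1.1 * \sum_l g e k l * e.2 o l).

(* U^{(a)}_{(i)}(t,x), entry (a, i): the linear part of the unique decomposition
   L = h^{ab} g_{ij} x^i_a x^j_b + U^{(a)}_{(i)}(t,x) x^i_a + F(t,x), which
   exists when p >= 2 (and then g does not depend on e.2). *)
Definition Ulin : 'rV[R]_p * 'rV[R]_n -> 'M[R]_(p, n) :=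
  xget (fun _ => 0 : 'M[R]_(p, n))
    [set U : 'rV[R]_p * 'rV[R]_n -> 'M[R]_(p, n) | exists F : 'rV[R]_p * 'rV[R]_n -> R,
    forall e, D e ->
      L e = \sum_a \sum_b \sum_i \sum_j
              hinv e.1.1 a b * g e i j * e.2 a i * e.2 b j
            + \sum_a \sum_i U e.1 a i * e.2 a i + F e.1].

(* U^{(b)}_{(k)j} *)
Definition Ucurl (b : 'I_p) (k j : 'I_n) (e : E) : R :=
  'D_(d_x j) (fun z : E => Ulin z.1 b k) e
  - 'D_(d_x k) (fun z : E => Ulin z.1 b j) e.

(* Gamma^i_{jk} *)
Definition Gam (i j k : 'I_n) (e : E) : R :=
  \sum_m ginv e i m / 2 *
    ('D_(d_x k) (fun z => g z m j) e + 'D_(d_x j) (fun z => g z m k) e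
     - 'D_(d_x m) (fun z => g z j k) e).

(* N^{(i)}_{(a)j} *)
Definition Ncon (i : 'I_n) (a : 'I_p) (j : 'I_n) (e : E) : R :=
  if p == 1%N then h e.1.1 a a * 'D_(d_y a j) (spray a i) e
  else \sum_k Gam i j k e * e.2 a k
       + \sum_k ginv e i k / 2 * 'D_(d_t a) (fun z => g z j k) e
       + \sum_k ginv e i k / 4 * \sum_b h e.1.1 a b * Ucurl b k j e.

Definition aidx := ('I_p + 'I_n + 'I_p * 'I_n)%type.
Definition iT (a : 'I_p) : aidx := inl (inl a).
Definition iM (i : 'I_n) : aidx := inl (inr i).
Definition iV (a : 'I_p) (i : 'I_n) : aidx := inr (a, i).

Definition frame (A : aidx) (e : E) : E :=
  match A with
  | inl (inl a) => (delta_mx 0 a, 0, \matrix_(b, j) - Mcon j b a e)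
  | inl (inr i) => (0, delta_mx 0 i, \matrix_(b, j) - Ncon j b i e)
  | inr (a, i) => d_y a i
  end.

Definition coframe (A : aidx) (e u : E) : R :=
  match A with
  | inl (inl a) => u.1.1 0 a
  | inl (inr i) => u.1.2 0 i
  | inr (a, i) => u.2 a i + \sum_b Mcon i a b e * u.1.1 0 b
                  + \sum_j Ncon i a j e * u.1.2 0 j
  end.

(* X_A(f) *)
Definition fder (A : aidx) (f : E -> R) (e : E) : R := 'D_(frame A e) f e.

(* G^k_{jc} *)
Definition Gcar (k j : 'I_n) (c : 'I_p) (e : E) : R :=
  \sum_i ginv e k i / 2 * fder (iT c) (fun z => g z i j) e.

(* L^i_{jk} *)
Definition Lcar (i j k : 'I_n) (e : E) : R :=
  \sum_m ginv e i m / 2 *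
    (fder (iM k) (fun z => g z m j) e + fder (iM j) (fun z => g z m k) e
     - fder (iM m) (fun z => g z j k) e).

(* C^{i(c)}_{j(k)} *)
Definition Ccar (i j : 'I_n) (c : 'I_p) (k : 'I_n) (e : E) : R :=
  \sum_m ginv e i m / 2 *
    (fder (iV c k) (fun z => g z m j) e + fder (iV c j) (fun z => g z m k) e
     - fder (iV c m) (fun z => g z j k) e).

(* nabla_{X_C} X_A = sum_B (cartan B A C) X_B *)
Definition cartan (B A C : aidx) (e : E) : R :=
  match C, A, B with
  | inl (inl c), inl (inl a), inl (inl m) => Hc m a c e.1.1
  | inl (inl c), inl (inr i), inl (inr k) => Gcar k i c e
  | inl (inl c), inr (a, i), inr (m, k) =>
      (a == m)%:R * Gcar k i c e - (k == i)%:R * Hc a m c e.1.1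
  | inl (inr j), inl (inr i), inl (inr k) => Lcar k i j e
  | inl (inr j), inr (a, i), inr (m, k) => (a == m)%:R * Lcar k i j e
  | inr (c, j), inl (inr i), inl (inr k) => Ccar k i c j e
  | inr (c, j), inr (a, i), inr (m, k) => (a == m)%:R * Ccar k i c j e
  | _, _, _ => 0
  end.

(* The linear connection with these coefficients, on arbitrary vector fields. *)
Definition nabla (X Y : E -> E) (e : E) : E :=
  \sum_B ('D_(X e) (fun z => coframe B z (Y z)) e
          + \sum_A \sum_C
              cartan B A C e * coframe A e (Y e) * coframe C e (X e))
         *: frame B e.

Definition lie (X Y : E -> E) (e : E) : E := 'D_(X e) Y e - 'D_(Y e) X e.

Definition curv (X Y Z : E -> E) (e : E) : E :=
  nabla X (nabla Y Z) e - nabla Y (nabla X Z) e - nabla (lie X Y) Z e.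

(* R_{AB} = R^D_{ABD}, where R(X_C, X_B) X_A = R^D_{ABC} X_D *)
Definition Rcomp (A B : aidx) (e : E) : R :=
  \sum_C coframe C e (curv (frame C) (frame B) (frame A) e).

Definition Ric (e u v : E) : R :=
  \sum_A \sum_B Rcomp A B e * coframe A e u * coframe B e v.

Definition Gpot (e u v : E) : R :=
  \sum_a \sum_b h e.1.1 a b * coframe (iT a) e u * coframe (iT b) e v
  + \sum_i \sum_j g e i j * coframe (iM i) e u * coframe (iM j) e v
  + \sum_a \sum_b \sum_i \sum_j hinv e.1.1 a b * g e i j
      * coframe (iV a i) e u * coframe (iV b j) e v.

(* G^{AB} *)
Definition Ginv (A B : aidx) (e : E) : R :=
  match A, B with
  | inl (inl a), inl (inl b) => hinv e.1.1 a b
  | inl (inr i), inl (inr j) => ginv e i j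
  | inr (a, i), inr (b, j) => h e.1.1 a b * ginv e i j
  | _, _ => 0
  end.

Definition Sc (e : E) : R := \sum_A \sum_B Ginv A B e * Rcomp A B e.

Definition Hscal (e : E) : R :=
  \sum_a \sum_b hinv e.1.1 a b * Rcomp (iT a) (iT b) e.
Definition Rscal (e : E) : R :=
  \sum_i \sum_j ginv e i j * Rcomp (iM i) (iM j) e.
Definition Sscal (e : E) : R :=
  \sum_a \sum_b \sum_i \sum_j
    h e.1.1 a b * ginv e i j * Rcomp (iV a i) (iV b j) e.

(* Ric(CGamma) - Sc(CGamma)/2 G = K tau, as (0,2) tensors at e. *)
Definition einstein (K : R) (tau : E -> {biscalar E}) (e : E) : Prop :=
  forall u v : E, Ric e u v - Sc e / 2 * Gpot e u v = K * tau e u v.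

Definition acomp (tau : E -> {biscalar E}) (A B : aidx) (e : E) : R :=
  tau e (frame A e) (frame B e).

End Local.

Arguments iT {p n} a.
Arguments iM {p n} i.
Arguments iV {p n} a i.

(* A function on J^1(T,M) is given on the classes [jet1 t f]; its values on
   other sets are irrelevant. *)
Definition lag_rep (R : realType) (p n : nat) (T : manifold R p)
    (M : manifold R n) (L : set (T * (T -> M)) -> R)
    (c : chart R p T) (d : chart R n M) : jcoord R p n -> R :=
  fun e => L (jet_of c d e).

Record ml_space (R : realType) (p n : nat) (T : manifold R p)
    (M : manifold R n) (h : semiriemannian T) := MLSpace {
  lag : set (T * (T -> M)) -> R;
  gmet : chart R p T -> chart R n M -> jcoord R p n -> 'M[R]_n;
  lag_smooth : forall c d, atlas c -> atlas d ->
    smooth_on (jet_dom c d) (lag_rep lag c d);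
  gmet_smooth : forall c d, atlas c -> atlas d ->
    smooth_on (jet_dom c d) (gmet c d);
  gmet_sym : forall c d e, atlas c -> atlas d -> jet_dom c d e ->
    (gmet c d e)^T = gmet c d e;
  gmet_rank : forall c d e, atlas c -> atlas d -> jet_dom c d e ->
    \rank (gmet c d e) = n;
  gmet_signature : exists q : nat, forall c d e, atlas c -> atlas d ->
    jet_dom c d e -> has_signature q (gmet c d e);
  gmet_dtensor : forall c c' d d' e, atlas c -> atlas c' -> atlas d ->
    atlas d' -> jet_overlap c c' d d' e ->
    gmet c d e = 'J (trans d d') e.1.2 *m gmet c' d' (jet_trans c c' d d' e)
                 *m ('J (trans d d') e.1.2)^T;
  lag_regular : forall c d, atlas c -> atlas d ->
    kronecker_regular (jet_dom c d) (h c) (gmet c d) (lag_rep lag c d) }.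

(* A smooth (0,2) tensor field on J^1(T,M), in induced coordinates; read in the
   adapted bases (see [acomp]) it is the same thing as a (0,2) d-tensor. *)
Record jet_tensor02 (R : realType) (p n : nat) (T : manifold R p)
    (M : manifold R n) := JetTensor02 {
  jtens :> chart R p T -> chart R n M ->
    jcoord R p n -> {biscalar (jcoord R p n)};
  jtens_smooth : forall c d u v, atlas c -> atlas d ->
    smooth_on (jet_dom c d) (fun e => jtens c d e u v);
  jtens_tensor : forall c c' d d' e u v, atlas c -> atlas c' -> atlas d ->
    atlas d' -> jet_overlap c c' d d' e ->
    jtens c d e u v = jtens c' d' (jet_trans c c' d d' e)
      ('d (jet_trans c c' d d') e u) ('d (jet_trans c c' d d') e v) }.

(* Main.v *)
(** Both sides of the Einstein equations are bilinear, so they amount to an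
    identity between components in the adapted frame, where Sc = H + R + S. The
    connection coefficients never mix the three kinds of frame vectors, the
    brackets of frame vectors are vertical, and H^c_{ab} depends on t only; hence
    Ric(d/dt, .) vanishes off the (T,T) block, and everywhere for p = 1.

    For p >= 2, let l^c_j be half of h_{bc} dL/dx^j_b. Kronecker regularity says
    dl^c_j/dx^i_a = delta^c_a g_ij, so on a fibre l^c_j, hence also g_ij, depends
    on the row x_c alone; this holds for two distinct c, so g is constant on the
    fibres. Then so are all the connection coefficients, those differentiating
    along vertical vectors vanish, and so does any R(X,Y) with X or Y vertical. *)
From HB Require Import structures.
Require Import Defs.
From mathcomp Require Import all_boot all_order all_algebra.
From mathcomp Require Import boolp classical_sets functions reals topology.
From mathcomp Require Import normedtype derive realfun.
From mathcomp Require Import ring.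

Set Implicit Arguments.
Unset Strict Implicit.
Unset Printing Implicit Defensive.
Import Order.TTheory GRing.Theory Num.Theory.
Import numFieldNormedType.Exports.

Local Open Scope classical_set_scope.
Local Open Scope ring_scope.

Section DirectionalDerivatives.
Context (R : realType).

Lemma constant_along_line (V : normedModType R) (f : V -> R) (z w : V) :
  (forall s : R, derivable f (s *: w + z) w) ->
  (forall s : R, 'D_w f (s *: w + z) = 0) -> f (w + z) = f z.
Proof.
move=> fd f0.
pose phi (s : R) := f (s *: w + z).
have quotE (s : R) :
    (fun r : R => r^-1 *: ((phi \o shift s) (r *: (1 : R)) - phi s))
    = (fun r : R =>
         r^-1 *: ((f \o shift (s *: w + z)) (r *: w) - f (s *: w + z))).
  apply/funext => r; rewrite /phi /= scalerDl addrA.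
  by rewrite [r *: 1]mulr1.
have : phi 1 = phi 0.
  apply: is_derive_0_is_cst => s; split.
    by rewrite /derivable quotE; exact: fd.
  by rewrite /derive quotE; exact: f0.
by rewrite /phi scale1r scale0r add0r.
Qed.

Lemma eq_derive_lines (V : normedModType R) (f : V -> R) (z z' u u' : V) :
  (forall r : R, f (r *: u + z) = f (r *: u' + z')) -> 'D_u f z = 'D_u' f z'.
Proof.
move=> ff; rewrite /derive.
have f0 : f z = f z' by have := ff 0; rewrite !scale0r !add0r.
rewrite (_ : (fun r : R => _) =
  (fun r : R => r^-1 *: ((f \o shift z') (r *: u') - f z'))) //.
by apply/funext => r; rewrite /= ff f0.
Qed.

Lemma derive_cst_line (V : normedModType R) (f : V -> R) (z u : V) :
  (forall r : R, f (r *: u + z) = f z) -> 'D_u f z = 0.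
Proof.
move=> fz; rewrite -(derive0 f z); apply: eq_derive_lines => r.
by rewrite fz scaler0 add0r.
Qed.

Context (p n : nat).
Local Notation E := (jcoord R p n).

(* No differentiability is assumed: where the limit does not exist, ['D_v f e]
   is the default point of the product, which is [0]. *)
Lemma derive_cst_fst (f : E -> E) (v e : E) k :
  (forall z, (f z).1 = k) -> ('D_v f e).1 = 0.
Proof.
move=> fk; rewrite /derive; set F := (X in lim X).
have [cF|/dvgP ->] := pselect (cvg F); last first.
  by congr pair; apply/matrixP => i j; rewrite !mxE.
have cF1 : (fun y => y.1) @ F --> (lim F).1.
  exact: (cvg_comp _ _ cF (@cvg_fst _ _ _ _ _)).
apply: (cvg_unique _ cF1); first exact: norm_hausdorff.
rewrite (_ : _ @ F = 0 @[_ --> (0 : R)^']); first exact: cvg_cst.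
rewrite /F -fmap_comp (_ : _ \o _ = fun=> 0) //; apply/funext => r /=.
by rewrite !fk subrr scaler0.
Qed.

Definition basic_on (D : set E) (T : Type) (f : E -> T) :=
  forall z z', D z -> D z' -> z.1 = z'.1 -> f z = f z'.

Lemma derive_basic (D : set E) (f : E -> R) (z z' u u' : E) :
  open D -> basic_on D f -> D z -> D z' -> z.1 = z'.1 -> u.1 = u'.1 ->
  'D_u f z = 'D_u' f z'.
Proof.
move=> oD fb Dz Dz' zz' uu'.
have Dnear (x w : E) : D x -> \forall r \near (0 : R)^', D (r *: w + x).
  move=> Dx; apply: cvg_within.
  have : (fun r : R => r *: w + x) @ (0 : R) --> 0 *: w + x.
    by apply: cvgD; [apply: cvgZr_tmp; exact: cvg_id | exact: cvg_cst].
  by apply; rewrite scale0r add0r; exact: open_nbhs_nbhs.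
rewrite /derive; congr (lim _).
have H : \forall r \near (0 : R)^',
   r^-1 *: ((f \o shift z) (r *: u) - f z)
   = r^-1 *: ((f \o shift z') (r *: u') - f z').
  near=> r; rewrite /= (fb z z') //; congr (_ *: (_ - _)); apply: fb.
  - by near: r; exact: Dnear.
  - by near: r; exact: Dnear.
  - by rewrite -[LHS]/(r *: u.1 + z.1) uu' zz'.
rewrite eqEsubset; split; apply: near_eq_cvg => //.
by near do apply/esym.
Unshelve. all: by end_near. Qed.

Lemma derive_basic_eq0 (D : set E) (f : E -> R) (z u : E) :
  open D -> basic_on D f -> D z -> u.1 = 0 -> 'D_u f z = 0.
Proof.
move=> oD fb Dz u0.
by rewrite (derive_basic (u' := 0) oD fb Dz Dz) // derive0.
Qed.

Lemma derive_eq0_on (D : set E) (f : E -> R) (z u : E) :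
  open D -> (forall x, D x -> f x = 0) -> D z -> 'D_u f z = 0.
Proof.
move=> oD f0 Dz; rewrite (@near_eq_derive _ _ _ _ (cst 0)) ?derive_cst //.
by near=> x; apply: f0; near: x; exact: open_nbhs_nbhs.
Unshelve. all: by end_near. Qed.

End DirectionalDerivatives.

Section AdaptedFrame.
Context (R : realType) (p n : nat).
Local Notation E := (jcoord R p n).
Context (D : set E) (h : 'rV[R]_p -> 'M[R]_p) (g : E -> 'M[R]_n) (L : E -> R).
Local Notation idx := (aidx p n).
Local Notation X := (frame D h g L).
Local Notation coX := (coframe D h g L).
Local Notation conn := (cartan D h g L).
Local Notation curvX C B A := (curv D h g L (X C) (X B) (X A)).
Implicit Types A B C : idx.

Lemma coframe_is_linear A e : linear_for *%R (coX A e).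
Proof.
move=> a u v; case: A => [[b|i]|[b i]] /=; rewrite ?mxE //.
rewrite !mulrDr !mulr_sumr.
under eq_bigr do rewrite !mxE mulrDr mulrCA.
under [in X in _ + X = _]eq_bigr do rewrite !mxE mulrDr mulrCA.
rewrite !big_split /=; ring.
Qed.

HB.instance Definition _ A e :=
  GRing.isLinear.Build R E R *%R (coX A e) (coframe_is_linear A e).

Lemma sum_idx (V : nmodType) (F : idx -> V) :
  \sum_A F A = \sum_a F (iT a) + \sum_i F (iM i) + \sum_a \sum_i F (iV a i).
Proof.
rewrite big_sumType /= big_sumType /= pair_bigA /=.
by congr (_ + _); apply: eq_bigr => -[].
Qed.

Let sum_delta m (F : 'I_m -> R) b : \sum_j F j * (delta_mx 0 b : 'rV[R]_m) 0 j = F b.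
Proof.
rewrite (bigD1 b) //= big1 => [|j jb]; rewrite mxE eqxx ?eqxx ?mulr1 ?addr0 //=.
by rewrite (negPf jb) mulr0.
Qed.

Let sum_mul0 m (F : 'I_m -> R) : \sum_j F j * (0 : 'rV[R]_m) 0 j = 0.
Proof. by apply: big1 => j _; rewrite mxE mulr0. Qed.

Lemma coframeB A e u v : coX A e (u - v) = coX A e u - coX A e v.
Proof. exact: raddfB. Qed.

Lemma coframe_frame A B e : coX A e (X B e) = (A == B)%:R.
Proof.
case: A => [[a|i]|[a i]]; case: B => [[b|j]|[b j]] //=; rewrite ?mxE ?eqxx //=.
- by rewrite sum_delta sum_mul0 addr0 addNr.
- by rewrite sum_delta sum_mul0 addr0 addNr.
- by rewrite !sum_mul0 !addr0.
Qed.

Lemma coframe_sum (c : idx -> R) B e : coX B e (\sum_A c A *: X A e) = c B.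
Proof.
rewrite linear_sum (bigD1 B) //= big1 => [|A AB].
  by rewrite linearZ /= coframe_frame eqxx mulr1 addr0.
by rewrite linearZ /= coframe_frame eq_sym (negPf AB) mulr0.
Qed.

Lemma coframe_eq e u v : (forall A, coX A e u = coX A e v) -> u = v.
Proof.
move=> uv.
have u0 : u.1.1 = v.1.1 by apply/rowP => a; exact: (uv (iT a)).
have u1 : u.1.2 = v.1.2 by apply/rowP => i; exact: (uv (iM i)).
have u2 : u.2 = v.2.
  apply/matrixP => a i; have := uv (iV a i); rewrite /= u0 u1 => /addIr.
  exact: addIr.
by case: u v u0 u1 u2 {uv} => [[? ?] ?] [[? ?] ?] /= -> -> ->.
Qed.

Lemma frame_coframe e u : u = \sum_A coX A e u *: X A e.
Proof. by apply: (@coframe_eq e) => B; rewrite coframe_sum. Qed.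

Lemma derive_coframe_frame u A B e : 'D_u (fun z => coX B z (X A z)) e = 0.
Proof.
rewrite (_ : (fun z => _) = cst (B == A)%:R) ?derive_cst //.
by apply/funext => z; rewrite coframe_frame.
Qed.

Lemma coframe_nabla_frame Y A D' e :
  coX D' e (nabla D h g L Y (X A) e) = \sum_C conn D' A C e * coX C e (Y e).
Proof.
rewrite coframe_sum derive_coframe_frame add0r (bigD1 A) //= [X in _ + X]big1.
  by rewrite addr0; apply: eq_bigr => C _; rewrite coframe_frame eqxx mulr1.
move=> B BA; apply: big1 => C _.
by rewrite coframe_frame (negPf BA) mulr0 mul0r.
Qed.

Lemma coframe_nabla_frames A B D' e :
  coX D' e (nabla D h g L (X B) (X A) e) = conn D' A B e.
Proof.
rewrite coframe_nabla_frame (bigD1 B) //= big1 => [|C CB].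
  by rewrite coframe_frame eqxx mulr1 addr0.
by rewrite coframe_frame (negPf CB) mulr0.
Qed.

Lemma coframe_nabla2 A B C D' e :
  coX D' e (nabla D h g L (X C) (nabla D h g L (X B) (X A)) e) =
  'D_(X C e) (conn D' A B) e + \sum_F conn F A B e * conn D' F C e.
Proof.
rewrite coframe_sum; congr (_ + _).
  by congr ('D__ _ _); apply/funext => z; rewrite coframe_nabla_frames.
apply: eq_bigr => F _; rewrite coframe_nabla_frames (bigD1 C) //= big1.
  by rewrite coframe_frame eqxx mulr1 addr0 mulrC.
by move=> G GC; rewrite coframe_frame (negPf GC) mulr0.
Qed.

Lemma coframe_curv A B C D' e : coX D' e (curvX C B A e) =
  ('D_(X C e) (conn D' A B) e + \sum_F conn F A B e * conn D' F C e)
  - ('D_(X B e) (conn D' A C) e + \sum_F conn F A C e * conn D' F B e)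
  - \sum_F conn D' A F e * coX F e (lie (X C) (X B) e).
Proof.
by rewrite /curv 2!coframeB 2!coframe_nabla2 coframe_nabla_frame.
Qed.

Lemma lie_frame_fst A B e : (lie (X A) (X B) e).1 = 0.
Proof.
have Xcst C : exists k, forall z, (X C z).1 = k.
  by case: C => [[a|i]|[a i]] /=; eexists => z; reflexivity.
have [a ha] := Xcst A; have [b hb] := Xcst B.
by rewrite /lie linearB /= (derive_cst_fst _ _ hb) (derive_cst_fst _ _ ha) subrr.
Qed.

Lemma coframe_lie_iT A B a e : coX (iT a) e (lie (X A) (X B) e) = 0.
Proof. by rewrite -[LHS]/((lie (X A) (X B) e).1.1 0 a) lie_frame_fst mxE. Qed.

Lemma coframe_lie_iM A B i e : coX (iM i) e (lie (X A) (X B) e) = 0.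
Proof. by rewrite -[LHS]/((lie (X A) (X B) e).1.2 0 i) lie_frame_fst mxE. Qed.

Lemma curv_alt Y Z e : curv D h g L Y Y Z e = 0.
Proof.
have lie0 z : lie Y Y z = 0 by rewrite /lie subrr.
rewrite /curv subrr sub0r; apply/eqP; rewrite oppr_eq0; apply/eqP.
apply: big1 => B _; rewrite lie0 derive0 add0r big1 ?scale0r // => A _.
by apply: big1 => C _; rewrite linear0 mulr0.
Qed.

Definition kind A : nat :=
  match A with inl (inl _) => 0 | inl (inr _) => 1 | inr _ => 2 end.

Lemma cartan_kind A B C : kind A != kind B -> conn B A C = fun=> 0.
Proof.
by case: A B C => [[?|?]|[? ?]] [[?|?]|[? ?]] [[?|?]|[? ?]] //= _.
Qed.

Lemma coframe_curv_kind A B C D' e : kind A != kind D' ->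
  coX D' e (curvX C B A e) = 0.
Proof.
move=> AD.
have s0 G G' : \sum_F conn F A G e * conn D' F G' e = 0.
  apply: big1 => F _; have [FD|FD] := eqVneq (kind F) (kind D').
    by rewrite cartan_kind ?mul0r // FD.
  by rewrite (@cartan_kind F D') ?mulr0.
rewrite coframe_curv !s0 !(cartan_kind _ AD) !derive_cst !addr0 subrr sub0r.
by rewrite big1 ?oppr0 // => F _; rewrite cartan_kind ?mul0r.
Qed.

Lemma cartan_iT A b C : kind C != 0%N -> conn (iT b) A C = fun=> 0.
Proof. by case: A C => [[?|?]|[? ?]] [[?|?]|[? ?]]. Qed.

Lemma Rcomp_iT a B e : kind B != 0%N -> Rcomp D h g L (iT a) B e = 0.
Proof.
move=> kB; apply: big1 => -[[c|k]|[c k]] _; last 2 first.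
- exact: coframe_curv_kind.
- exact: coframe_curv_kind.
have XB11 : (X B e).1.1 = 0 by case: B kB => [[]|[]].
rewrite -/(iT c) coframe_curv cartan_iT // derive_cst.
rewrite (@derive_cst_line _ _ (conn (iT c) (iT a) (iT c))); last first.
  by move=> r; rewrite /= XB11 scaler0 add0r.
rewrite !big1 ?addr0 ?subr0 // => F _.
- case: F => [[f|j]|[f j]]; [|exact: mul0r..].
  by rewrite -/(iT f) coframe_lie_iT mulr0.
- by rewrite mulrC cartan_iT ?mul0r.
- have [F0|F0] := eqVneq (kind F) 0%N.
    by case: F F0 => [[f|j]|[f j]] //= _; rewrite -/(iT f) cartan_iT ?mul0r.
  by rewrite cartan_kind ?mul0r // eq_sym.
Qed.

Lemma Rcomp_iT_iT a b e : (forall c : 'I_p, c = b) ->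
  Rcomp D h g L (iT a) (iT b) e = 0.
Proof.
move=> Ib; apply: big1 => -[[c|k]|[c k]] _; last 2 first.
- exact: coframe_curv_kind.
- exact: coframe_curv_kind.
by rewrite (Ib c) curv_alt linear0.
Qed.

Section BasicMetric.
Hypotheses (D_open : open D) (g_basic : basic_on D g).

Lemma fder_g_basic A i j : basic_on D (fder D h g L A (fun z => g z i j)).
Proof.
move=> z z' Dz Dz' zz'; apply: (derive_basic D_open) zz' _ => //.
  by move=> x x' Dx Dx' xx'; rewrite (g_basic Dx Dx' xx').
by case: A => [[a|k]|[a k]].
Qed.

Lemma fder_g_iV a k i j z : D z -> fder D h g L (iV a k) (fun z => g z i j) z = 0.
Proof.
move=> Dz; apply: (derive_basic_eq0 D_open) Dz _ => //.
by move=> x x' Dx Dx' xx'; rewrite (g_basic Dx Dx' xx').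
Qed.

Lemma cartan_basic A B C : basic_on D (conn B A C).
Proof.
move=> z z' Dz Dz' zz'; have g_inv : ginv g z = ginv g z'.
  by rewrite /ginv (g_basic Dz Dz' zz').
have Geq k i c : Gcar D h g L k i c z = Gcar D h g L k i c z'.
  by apply: eq_bigr => m _; rewrite g_inv; congr (_ * _); exact: fder_g_basic.
have Leq k i c : Lcar D h g L k i c z = Lcar D h g L k i c z'.
  apply: eq_bigr => m _; rewrite g_inv.
  by congr (_ * (_ + _ - _)); exact: fder_g_basic.
have Ceq k i c j : Ccar D h g L k i c j z = Ccar D h g L k i c j z'.
  apply: eq_bigr => m _; rewrite g_inv.
  by congr (_ * (_ + _ - _)); exact: fder_g_basic.
by case: A B C => [[?|?]|[? ?]] [[?|?]|[? ?]] [[?|?]|[? ?]] //=;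
  rewrite ?Geq ?Leq ?Ceq ?zz'.
Qed.

Lemma cartan_iV A B c k z : D z -> conn B A (iV c k) z = 0.
Proof.
move=> Dz; have C0 i j : Ccar D h g L i j c k z = 0.
  by apply: big1 => m _; rewrite !fder_g_iV // addr0 subr0 mulr0.
by case: A B => [[?|?]|[? ?]] [[?|?]|[? ?]] //=; rewrite C0 // mulr0.
Qed.

Lemma coframe_curv_iV A B C D' e : D e -> kind B == 2 \/ kind C == 2 ->
  coX D' e (curvX C B A e) = 0.
Proof.
have iVE F : kind F == 2 -> exists a i, F = iV a i.
  by case: F => [[]|[a i]] //= _; exists a, i.
move=> De BC; rewrite coframe_curv [X in _ - X]big1 => [|F _]; last first.
  case: F => [[f|j]|[f j]].
  - by rewrite -/(iT f) coframe_lie_iT mulr0.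
  - by rewrite -/(iM j) coframe_lie_iM mulr0.
  - by rewrite -/(iV f j) cartan_iV // mul0r.
have conn_sum0 F G : kind F == 2 \/ kind G == 2 ->
    \sum_K conn K A F e * conn D' K G e = 0.
  move=> FG; apply: big1 => K _; case: FG => /iVE[a [i ->]].
    by rewrite cartan_iV ?mul0r.
  by rewrite mulrC cartan_iV ?mul0r.
have dconn0 F G : kind F == 2 \/ kind G == 2 -> 'D_(X F e) (conn D' A G) e = 0.
  case=> /iVE[a [i ->]]; first exact: (derive_basic_eq0 D_open (cartan_basic _ _ _)).
  by apply: (derive_eq0_on _ D_open _ De) => z; exact: cartan_iV.
have CB : kind C == 2 \/ kind B == 2 by rewrite orC.
by rewrite !conn_sum0 // !dconn0 // !addr0 !subr0.
Qed.

Lemma Rcomp_iV_r A a i e : D e -> Rcomp D h g L A (iV a i) e = 0.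
Proof. by move=> De; apply: big1 => C _; apply: coframe_curv_iV => //; left. Qed.

Lemma Rcomp_iV_l a i B e : D e -> Rcomp D h g L (iV a i) B e = 0.
Proof.
move=> De; apply: big1 => C _; have [C2|C2] := eqVneq (kind C) 2.
  by apply: coframe_curv_iV => //; right; apply/eqP.
by apply: coframe_curv_kind; rewrite eq_sym.
Qed.

End BasicMetric.

Lemma sum_coframe_frame (F : idx -> idx -> R) A B e :
  \sum_A' \sum_B' F A' B' * coX A' e (X A e) * coX B' e (X B e) = F A B.
Proof.
rewrite (bigD1 A) //= [X in _ + X]big1 => [|A' AA']; last first.
  by apply: big1 => B' _; rewrite coframe_frame (negPf AA') mulr0 mul0r.
rewrite addr0 (bigD1 B) //= [X in _ + X]big1 => [|B' BB'].
  by rewrite !coframe_frame !eqxx !mulr1 addr0.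
by rewrite [X in _ * X]coframe_frame (negPf BB') mulr0.
Qed.

Definition metric_comp A B (e : E) : R :=
  match A, B with
  | inl (inl a), inl (inl b) => h e.1.1 a b
  | inl (inr i), inl (inr j) => g e i j
  | inr (a, i), inr (b, j) => hinv h e.1.1 a b * g e i j
  | _, _ => 0
  end.

Lemma sum_blocks (F : idx -> idx -> R) :
  (forall A B, kind A != kind B -> F A B = 0) ->
  \sum_A \sum_B F A B = \sum_a \sum_b F (iT a) (iT b)
    + \sum_i \sum_j F (iM i) (iM j)
    + \sum_a \sum_b \sum_i \sum_j F (iV a i) (iV b j).
Proof.
move=> F0; rewrite sum_idx; congr (_ + _ + _).
- apply: eq_bigr => a _; rewrite sum_idx [X in _ + X + _]big1 => [|j _]; last exact: F0.
  by rewrite [X in _ + X]big1 ?addr0 // => b _; apply: big1 => j _; exact: F0.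
- apply: eq_bigr => i _; rewrite sum_idx big1 ?add0r => [|a _]; last exact: F0.
  by rewrite [X in _ + X]big1 ?addr0 // => b _; apply: big1 => j _; exact: F0.
- apply: eq_bigr => a _; rewrite [RHS]exchange_big; apply: eq_bigr => i _.
  rewrite sum_idx big1 => [|b _]; last exact: F0.
  by rewrite big1 ?add0r // => j _; exact: F0.
Qed.

Lemma Gpot_sum e u v : Gpot D h g L e u v =
  \sum_A \sum_B metric_comp A B e * coX A e u * coX B e v.
Proof.
rewrite sum_blocks // => A B.
by case: A B => [[a|i]|[a i]] [[b|j]|[b j]] //= _; rewrite !mul0r.
Qed.

Lemma Sc_sum e : Sc D h g L e = Hscal D h g L e + Rscal D h g L e + Sscal D h g L e.
Proof.
rewrite /Sc sum_blocks // => A B.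
by case: A B => [[a|i]|[a i]] [[b|j]|[b j]] //= _; rewrite mul0r.
Qed.

Lemma Gpot_frame A B e : Gpot D h g L e (X A e) (X B e) = metric_comp A B e.
Proof.
rewrite Gpot_sum; exact: sum_coframe_frame.
Qed.

Lemma Ric_frame A B e : Ric D h g L e (X A e) (X B e) = Rcomp D h g L A B e.
Proof. exact: sum_coframe_frame. Qed.

Lemma acomp_sum (tau : E -> {biscalar E}) e u v : tau e u v =
  \sum_A \sum_B acomp D h g L tau A B e * coX A e u * coX B e v.
Proof.
rewrite {1}(frame_coframe e u) {1}(frame_coframe e v) linear_sumlz.
apply: eq_bigr => A _; rewrite linear_sumr; apply: eq_bigr => B _.
by rewrite linearZl_LR linearZr_LR /= mulrA mulrC mulrA.
Qed.

Lemma einsteinP K (tau : E -> {biscalar E}) e : einstein D h g L K tau e <->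
  forall A B, Rcomp D h g L A B e - Sc D h g L e / 2 * metric_comp A B e
              = K * acomp D h g L tau A B e.
Proof.
split=> [ein A B|ein u v]; first by rewrite -Ric_frame -Gpot_frame ein.
rewrite /Ric Gpot_sum acomp_sum !mulr_sumr -sumrB; apply: eq_bigr => A _.
rewrite !mulr_sumr -sumrB; apply: eq_bigr => B _.
by rewrite !mulrA -ein !mulrBl.
Qed.

End AdaptedFrame.

Lemma vertical_sum (R : realType) (p n : nat) (u : jcoord R p n) :
  u.1 = 0 -> u = \sum_a \sum_i u.2 a i *: d_y R a i.
Proof.
move=> u0; rewrite [RHS]surjective_pairing [LHS]surjective_pairing; congr pair.
  rewrite u0 (raddf_sum fst) big1 // => a _.
  rewrite (raddf_sum fst) big1 // => i _.
  by rewrite -[LHS]/(_ *: 0) scaler0.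
rewrite (raddf_sum snd); apply: etrans (matrix_sum_delta _) _.
apply: eq_bigr => a _.
by rewrite (raddf_sum snd).
Qed.

Section KroneckerRegular.
Context (R : realType) (p n : nat).
Local Notation E := (jcoord R p n).
Context (D : set E) (h : 'rV[R]_p -> 'M[R]_p) (g : E -> 'M[R]_n) (L : E -> R).
Hypotheses (D_fibre : forall z z' : E, z.1 = z'.1 -> D z -> D z')
  (h_unit : forall z, D z -> h z.1.1 \in unitmx)
  (dL_diff : forall b j z, D z -> differentiable ('D_(d_y R b j) L) z)
  (L_regular : kronecker_regular D h g L).

(* Half the conjugate momentum of L, with its Greek index lowered by h(t). *)
Let momentum (t : 'rV[R]_p) (c : 'I_p) (j : 'I_n) : E -> R :=
  \sum_b (h t b c / 2) *: 'D_(d_y R b j) L.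

Let momentum_diff t c j z : D z -> differentiable (momentum t c j) z.
Proof.
by move=> Dz; apply: differentiable_sum => b; apply: differentiableZ; exact: dL_diff.
Qed.

Let derive_momentum c j z a i : D z ->
  'D_(d_y R a i) (momentum z.1.1 c j) z = (a == c)%:R * g z i j.
Proof.
move=> Dz; rewrite derive_sum => [|b]; last first.
  by apply: derivableZ; apply: diff_derivable; exact: dL_diff.
transitivity (\sum_b hinv h z.1.1 a b * h z.1.1 b c * g z i j).
  apply: eq_bigr => b _; rewrite deriveZ; last first.
    by apply: diff_derivable; exact: dL_diff.
  rewrite mulrAC -(L_regular a b i j Dz) -[LHS]/(_ * _); ring.
rewrite -mulr_suml; congr (_ * _).
have := mulVmx (h_unit Dz) => /matrixP/(_ a c); rewrite !mxE => <-.
by [].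
Qed.

Let momentum_row c j z z' : D z -> z.1 = z'.1 -> row c z.2 = row c z'.2 ->
  momentum z.1.1 c j z' = momentum z.1.1 c j z.
Proof.
move=> Dz zz' zc; have w0 : (z' - z).1 = 0.
  by rewrite -[LHS]/(z'.1 - z.1) zz' subrr.
have line1 s : (s *: (z' - z) + z).1 = z.1.
  by rewrite -[LHS]/(s *: (z' - z).1 + z.1) w0 scaler0 add0r.
have Dline s : D (s *: (z' - z) + z) by apply: D_fibre Dz; rewrite line1.
rewrite -[z' in LHS](subrK z); apply: constant_along_line => s.
  by apply: diff_derivable; exact: momentum_diff.
rewrite deriveE; last exact: momentum_diff.
set x := s *: _ + z; have Dx : D x := Dline s.
rewrite (vertical_sum w0) linear_sum big1 // => a _.
rewrite linear_sum big1 // => i _.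
rewrite linearZ /= -deriveE; last exact: momentum_diff.
rewrite -[z.1.1](congr1 fst (line1 s)) -/x derive_momentum //.
have [->|] := eqVneq a c; last by rewrite mul0r scaler0.
have := congr1 (fun r : 'rV_n => r 0 i) zc; rewrite !mxE => ->.
by rewrite subrr scale0r.
Qed.

(* Each row of fibre coordinates determines g on its own, by [momentum_row];
   with two rows available, g cannot depend on either. *)
Lemma kronecker_basic : (1 < p)%N -> basic_on D g.
Proof.
have g_row c z z' : D z -> z.1 = z'.1 -> row c z.2 = row c z'.2 -> g z = g z'.
  move=> Dz zz' zc; have Dz' := D_fibre zz' Dz.
  apply/matrixP => i j; have := derive_momentum c j c i Dz.
  have := derive_momentum c j c i Dz'; rewrite eqxx !mul1r => <- <-.
  rewrite -zz'; apply: eq_derive_lines => r.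
  have fst_eq (x : E) : (r *: d_y R c i + x).1 = x.1.
    by rewrite -[LHS]/(r *: 0 + x.1) scaler0 add0r.
  have := fst_eq z => /(congr1 fst) <-; apply/esym/momentum_row.
  - exact: D_fibre (esym (fst_eq z)) Dz.
  - by rewrite !fst_eq.
  - apply/rowP => k; have := congr1 (fun u : 'rV_n => u 0 k) zc.
    by rewrite !mxE => ->.
move=> p1 z z' Dz Dz' zz'.
pose c0 := Ordinal (ltnW p1); pose c1 := Ordinal p1.
pose y : E := (z.1, \matrix_(a, i) (if a == c0 then z.2 a i else z'.2 a i)).
have Dy : D y by apply: D_fibre Dz.
have -> : g z = g y.
  by apply: (g_row c0) => //; apply/rowP => i; rewrite !mxE eqxx.
by apply: (g_row c1) => //; apply/rowP => i; rewrite !mxE.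
Qed.

End KroneckerRegular.

Lemma has_signature_unitmx (R : realType) (n q : nat) (A : 'M[R]_n) :
  has_signature q A -> A \in unitmx.
Proof.
case=> _ [P Pu PA]; have : P *m A *m P^T \in unitmx.
  rewrite PA unitmxE det_diag unitfE; apply/prodf_neq0 => i _.
  by rewrite mxE; case: ifP; rewrite ?oppr_eq0 oner_eq0.
by rewrite !unitmx_mul => /andP[/andP[]].
Qed.

Lemma jet_dom_open (R : realType) (p n : nat) (T : manifold R p)
    (M : manifold R n) (c : chart R p T) (d : chart R n M) : open (jet_dom c d).
Proof.
rewrite (_ : jet_dom c d = [set e | chart_im c e.1.1] `&` [set e | chart_im d e.1.2]) //.
apply: openI.
- apply: (@open_comp _ _ (fun e : jcoord R p n => e.1.1)); last exact: chart_im_open.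
  move=> e _; apply: continuous_comp; exact: cvg_fst.
- apply: (@open_comp _ _ (fun e : jcoord R p n => e.1.2)); last exact: chart_im_open.
  move=> e _; apply: continuous_comp; [exact: cvg_fst | exact: cvg_snd].
Qed.

Theorem theorem4p3 :
  forall (R : realType) (p n : nat) (T : manifold R p) (M : manifold R n)
    (h : semiriemannian T) (S : ml_space M h) (tau : jet_tensor02 T M) (K : R),
  K != 0 ->
  forall (c : chart R p T) (d : chart R n M) (e : jcoord R p n),
  atlas c -> atlas d -> jet_dom c d e ->
  let D := jet_dom c d in
  let hc := h c in
  let g := gmet S c d in
  let L := lag_rep (lag S) c d in
  let ric A B := Rcomp D hc g L A B e in
  let T_ A B := acomp D hc g L (tau c d) A B e in
  let hh := hc e.1.1 in
  let hi := hinv hc e.1.1 in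
  let Hs := Hscal D hc g L e in
  let Rs := Rscal D hc g L e in
  let Ss := Sscal D hc g L e in
  (p = 1%N -> forall o : 'I_p,
    (einstein D hc g L K (tau c d) e <->
      (- ((Rs + Ss) / 2) * hh o o = K * T_ (iT o) (iT o)
      /\ (forall i j, ric (iM i) (iM j) - (Rs + Ss) / 2 * g e i j
                      = K * T_ (iM i) (iM j))
      /\ (forall i j, ric (iV o i) (iV o j) - (Rs + Ss) / 2 * hi o o * g e i j
                      = K * T_ (iV o i) (iV o j))
      /\ (forall i, 0 = T_ (iT o) (iM i))
      /\ (forall i, ric (iM i) (iT o) = K * T_ (iM i) (iT o))
      /\ (forall i, ric (iV o i) (iT o) = K * T_ (iV o i) (iT o))
      /\ (forall i, 0 = T_ (iT o) (iV o i))
      /\ (forall i j, ric (iM i) (iV o j) = K * T_ (iM i) (iV o j))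
      /\ (forall i j, ric (iV o i) (iM j) = K * T_ (iV o i) (iM j)))))
  /\
  ((2 <= p)%N ->
    (einstein D hc g L K (tau c d) e <->
      ((forall a b, ric (iT a) (iT b) - (Hs + Rs) / 2 * hh a b
                    = K * T_ (iT a) (iT b))
      /\ (forall i j, ric (iM i) (iM j) - (Hs + Rs) / 2 * g e i j
                      = K * T_ (iM i) (iM j))
      /\ (forall a b i j, - ((Hs + Rs) / 2) * hi a b * g e i j
                          = K * T_ (iV a i) (iV b j))
      /\ (forall a i, 0 = T_ (iT a) (iM i))
      /\ (forall a i, ric (iM i) (iT a) = K * T_ (iM i) (iT a))
      /\ (forall a b i, 0 = T_ (iV a i) (iT b))
      /\ (forall a b i, 0 = T_ (iT a) (iV b i))
      /\ (forall a i j, 0 = T_ (iM i) (iV a j))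
      /\ (forall a i j, 0 = T_ (iV a i) (iM j))))).
Proof.
move=> R p n T M h S tau K K0 c d e ac ad De /=.
set D := jet_dom c d in De *.
have D_open : open D by exact: jet_dom_open.
have K_eq0 x : K * x = 0 <-> 0 = x.
  by split=> [/eqP|<-]; [rewrite mulf_eq0 (negPf K0) => /eqP | rewrite mulr0].
split=> [p1 o|p2]; rewrite einsteinP Sc_sum.
- have Io (a : 'I_p) : a = o.
    have val0 (b : 'I_p) : b = 0%N :> nat.
      by have := leq_trans (ltn_ord b) (eq_leq p1); rewrite ltnS leqn0 => /eqP.
    by apply: ord_inj; rewrite !val0.
  have TT a b : Rcomp D (h c) (gmet S c d) (lag_rep (lag S) c d) (iT a) (iT b) e = 0.
    by apply: Rcomp_iT_iT => a'; rewrite (Io b).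
  have -> : Hscal D (h c) (gmet S c d) (lag_rep (lag S) c d) e = 0.
    by apply: big1 => a _; apply: big1 => b _; rewrite TT mulr0.
  rewrite add0r; split=> [ein|[eTT [eMM [eVV [eTM [eMT [eVT [eTV [eMV eVM]]]]]]]] A B].
  + do !split; move=> *.
    * by rewrite -ein TT sub0r mulNr.
    * by rewrite -ein.
    * by rewrite -ein mulrA.
    * by apply/K_eq0; rewrite -ein Rcomp_iT // mulr0 subr0.
    * by rewrite -ein mulr0 subr0.
    * by rewrite -ein mulr0 subr0.
    * by apply/K_eq0; rewrite -ein Rcomp_iT // mulr0 subr0.
    * by rewrite -ein mulr0 subr0.
    * by rewrite -ein mulr0 subr0.
  + case: A B => [[a|i]|[a i]] [[b|j]|[b j]] /=; rewrite ?(Io a) ?(Io b) ?mulr0 ?subr0.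
    * by rewrite TT sub0r -mulNr eTT.
    * by rewrite Rcomp_iT // -eTM mulr0.
    * by rewrite Rcomp_iT // -eTV mulr0.
    * exact: eMT.
    * exact: eMM.
    * exact: eMV.
    * exact: eVT.
    * exact: eVM.
    * by rewrite mulrA eVV.
- have g_basic : basic_on D (gmet S c d).
    apply: (@kronecker_basic _ _ _ D (h c) (gmet S c d) (lag_rep (lag S) c d)) p2.
    + by rewrite /D /jet_dom /= => z z' ->.
    + move=> z [cz _]; have [q hq] := met_signature h.
      exact: has_signature_unitmx (hq c _ ac cz).
    + by move=> b j z Dz; exact: (lag_smooth S ac ad [:: d_y R b j] Dz).
    + exact: lag_regular.
  have -> : Sscal D (h c) (gmet S c d) (lag_rep (lag S) c d) e = 0.
    apply: big1 => a _; apply: big1 => b _; apply: big1 => i _; apply: big1 => j _.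
    by rewrite Rcomp_iV_r // mulr0.
  rewrite addr0; split=> [ein|[eTT [eMM [eVV [eTM [eMT [eVT [eTV [eMV eVM]]]]]]]] A B].
  + do !split; move=> *.
    * by rewrite -ein.
    * by rewrite -ein.
    * by rewrite -ein Rcomp_iV_r // sub0r -mulrA mulNr.
    * by apply/K_eq0; rewrite -ein Rcomp_iT // mulr0 subr0.
    * by rewrite -ein mulr0 subr0.
    * by apply/K_eq0; rewrite -ein Rcomp_iV_l // mulr0 subr0.
    * by apply/K_eq0; rewrite -ein Rcomp_iT // mulr0 subr0.
    * by apply/K_eq0; rewrite -ein Rcomp_iV_r // mulr0 subr0.
    * by apply/K_eq0; rewrite -ein Rcomp_iV_l // mulr0 subr0.
  + case: A B => [[a|i]|[a i]] [[b|j]|[b j]] /=; rewrite ?mulr0 ?subr0.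
    * exact: eTT.
    * by rewrite Rcomp_iT // -eTM mulr0.
    * by rewrite Rcomp_iT // -eTV mulr0.
    * exact: eMT.
    * exact: eMM.
    * by rewrite Rcomp_iV_r // -eMV mulr0.
    * by rewrite Rcomp_iV_l // -eVT mulr0.
    * by rewrite Rcomp_iV_l // -eVM mulr0.
    * by rewrite Rcomp_iV_r // sub0r -mulNr mulrA eVV.
Qed.
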